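(* (a) Fix $a,b\in\mathbb{N}$. Then $$\lim_{N\to\infty}P_N\left(S^{\bullet}(N,N-a+1,b)\right)=\rho(a,b).$$ (b) More generally, let $k\in\mathbb{N}$ and let $a_1,\ldots,a_k,b_1,\ldots,b_k\in\mathbb{N}$ be fixed. Define $A_m=\sum_{l=1}^m a_l$ and $B_m=\sum_{l=1}^m b_l$ for $m=1,\ldots,k$. Then, as $N\to\infty$, $$P_N\left(S^{\searrow k}(N,N-A_k+1,\ldots,N-A_1+1,B_k,\ldots,B_1)\right)=\left[\prod_{v=1}^k\rho(a_v,b_v)\right]\left(1+O(N^{-1})\right).$$
   Context: $\mathbb{N}$ denotes the positive integers. $S_N(312)$ is the set of permutations $\sigma=\sigma_1\ldots\sigma_N$ of $1,\dots,N$ for which there are no indices $i_1<i_2<i_3$ with $\sigma_{i_1}>\sigma_{i_3}>\sigma_{i_2}$. $P_N$ is the uniform probability distribution on $S_N(312)$. $S^{\bullet}(N,i,j)=\{\sigma\in S_N(312):\sigma_i=j\}$. For positions $p_1<\cdots<p_k$ in $[1,N]$ and values $v_k<\cdots<v_1<p_1$, $S^{\searrow k}(N,p_1,\ldots,p_k,v_1,\ldots,v_k)=\{\sigma\in S_N(312):\sigma_{p_1}=v_1,\ldots,\sigma_{p_k}=v_k\}$; thus the set in (b) is $\{\sigma\in S_N(312):\sigma_{N-A_m+1}=B_m\text{ for }m=1,\ldots,k\}$. For $a,b\in\mathbb{N}$, $$\rho(a,b)=\sum_{i_0=\max\{1,b-a+1\}}^{b}\frac{(b-i_0+1)^2}{b\,a\,4^{i_0+a-1}}\binom{i_0+2(a-1)-b}{a-1}\binom{i_0+b-2}{b-1}.$$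 *)

(* Defs.v *)
From HB Require Import structures.
From mathcomp Require Import all_boot all_order all_algebra all_fingroup.
From mathcomp Require Import all_classical all_reals all_analysis.

Set Implicit Arguments.
Unset Strict Implicit.
Unset Printing Implicit Defensive.

Import Order.TTheory GRing.Theory Num.Theory.
Import numFieldNormedType.Exports.

Local Open Scope ring_scope.

Definition avoids312 (N : nat) (s : 'S_N) : bool :=
  [forall i1 : 'I_N, forall i2 : 'I_N, forall i3 : 'I_N,
    ~~ [&& (i1 < i2)%N, (i2 < i3)%N, (s i3 < s i1)%N & (s i2 < s i3)%N]].

Definition S312 (N : nat) : {set 'S_N} := [set s : 'S_N | avoids312 s].

Definition P312 (R : realType) (N : nat) (E : {set 'S_N}) : R :=
  #|E :&: S312 N|%:R / #|S312 N|%:R.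

(* Positions and values are 1-based naturals, whereas elements of 'I_N are
   0-based; [takes s i j] is false unless i and j both lie in [1, N]. *)
Definition takes (N : nat) (s : 'S_N) (i j : nat) : bool :=
  [exists x : 'I_N, (x.+1 == i) && ((s x).+1 == j)].

Definition Spoint (N i j : nat) : {set 'S_N} :=
  [set s in S312 N | takes s i j].

(* [p m] and [v m] stand for the 1-based p_{m+1} and v_{m+1}. *)
Definition Sdesc (k N : nat) (p v : 'I_k -> nat) : {set 'S_N} :=
  [set s in S312 N | [forall m : 'I_k, takes s (p m) (v m)]].

(* With a_{l+1} = [a l], this is the partial sum a_1 + ... + a_{m+1}. *)
Definition psum (k : nat) (a : 'I_k -> nat) (m : 'I_k) : nat :=
  (\sum_(l < k | (l <= m)%N) a l)%N.

(* For a, b >= 1 no subtraction below truncates, except b - a + 1, where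
   truncation does not change the maximum with 1. *)
Definition rho (R : realType) (a b : nat) : R :=
  \sum_(maxn 1 (b - a + 1) <= i0 < b.+1)
     ((b - i0 + 1) ^ 2)%N%:R / (b * a * 4 ^ (i0 + a - 1))%N%:R
     * 'C(i0 + 2 * (a - 1) - b, a - 1)%:R
     * 'C(i0 + b - 2, b - 1)%:R.

(* Main.v *)
Require Import Defs.
From HB Require Import structures.
From mathcomp Require Import all_boot all_order all_algebra all_fingroup.
From mathcomp Require Import all_classical all_reals all_analysis.
From mathcomp Require Import zify ring lra.

Set Implicit Arguments.
Unset Strict Implicit.
Unset Printing Implicit Defensive.

Import Order.TTheory GRing.Theory Num.Theory.
Import numFieldNormedType.Exports.

(** Read a 312-avoiding permutation from right to left: it becomes a word that
    avoids 213, and the point at position N - A + 1 becomes its A-th letter, so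
    that the points of interest sit at fixed places of the word while N grows.
    Writing such a word as q 0 p, avoidance forces every letter of q to exceed
    every letter of p, and q, p are then arbitrary 213-avoiding words up to
    relabelling ([sum_words]).  This gives Segner's recurrence for the Catalan
    numbers C_N, and also a recurrence for the number of words through a
    decreasing (in the permutation) chain of points ([hit_count_rec]).  Indeed
    a chain of points, each higher than the next one to its right, cannot
    meet both q and p: it lies entirely in q, or entirely in p, or its first,
    rightmost point is the letter 0 and the others lie in p.

    Let f_N(a, b; rest) be the count for the chain with increments
    (a, b), rest.  The recurrence expresses it by boundedly many terms
    C_l f_{N-l-1}(a, b-l-1; rest), C_r f_{N-r-1}(a-r-1, b-1; rest) and, when
    b = 1, C_{a-1} f_{N-a}(rest); the case where both factors of the
    decomposition are large contributes nothing to the count.  Divide by C_N.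
    Since C_{N-s}/C_N = 4^-s + O(1/N), induction on the chain and on b shows
    that f_N/C_N has a limit with error O(1/N) ([rate_hit_freq]).  The limit of
    the whole chain satisfies the recurrence for (a, b) times the limit for
    the rest, whence the product form.

    It remains to solve that limiting recurrence.  With c the Catalan
    generating function, u = x c(x) and v = y c(y), the solution is
    4^-(a+b) [x^a y^b] 4uv/(1 - 4uv) = 4^-(a+b) sum_(k>=1) 4^k B(k,a) B(k,b),
    where B(k,n) = [x^n] (x c(x))^k is a ballot number ([rho_ballot_rec]).  It
    rests on v = y + v^2, which on coefficients is [ballot_rec].  The same
    triangular recurrence yields B(k,n) = (k/n) binomial(2n-k-1, n-1), and
    inserting this formula turns the sum into rho(a,b) ([rho_ballotE]), after
    the substitution k = b - i0 + 1.  The case k = 1 of the formula is the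
    closed form of C_n, from which C_{N-1}/C_N = 1/4 + O(1/N).

    All rho(a,b) being positive, the additive error becomes a relative one,
    which is (b); and (a) is the case of a single point. *)

(** * Words avoiding 213 and their decomposition at the letter 0 *)

(** With values x, y, z in this order, y < x < z is the mirror image of the
    pattern 312. *)
Fixpoint avoids213 (w : seq nat) : bool :=
  if w is x :: w' then
    pairwise (fun y z => ~~ ((y < x) && (x < z))) w' && avoids213 w'
  else true.

Definition words (n : nat) : seq (seq nat) :=
  [seq w <- permutations (iota 0 n) | avoids213 w].

(** The letters are shifted so that the result is again a word on an initial
    segment of the naturals with q entirely above 0 :: p. *)
Definition glue (q p : seq nat) : seq nat :=
  [seq (size p).+1 + x | x <- q] ++ 0 :: [seq x.+1 | x <- p].

Lemma mem_words n w : (w \in words n) = avoids213 w && perm_eq w (iota 0 n).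
Proof. by rewrite mem_filter mem_permutations. Qed.

Lemma uniq_words n : uniq (words n).
Proof. exact/filter_uniq/permutations_uniq. Qed.

Lemma size_word n w : w \in words n -> size w = n.
Proof. by rewrite mem_words => /andP[_ /perm_size ->]; rewrite size_iota. Qed.

(** Positional form of avoidance, which is how permutations state it. *)
Lemma avoids213P w :
  reflect (forall i j k, i < j -> j < k -> k < size w ->
             ~~ ((nth 0 w j < nth 0 w i) && (nth 0 w i < nth 0 w k)))
          (avoids213 w).
Proof.
elim: w => [|x w IH] /=; first by apply: ReflectT.
apply: (iffP andP) => [[/(pairwiseP 0) hx /IH hw] i j k ij jk kw|h].
  case: i j k ij jk kw => [|i] [|j] [|k] //= ij jk kw; last exact: hw.
  by apply: hx => //; rewrite inE; lia.
split; last by apply/IH => i j k ij jk kw; apply: (h i.+1 j.+1 k.+1).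
apply/(pairwiseP 0) => j k; rewrite !inE => _ kw jk.
exact: (h 0 j.+1 k.+1).
Qed.

Lemma avoids213_map (f : nat -> nat) w :
  {mono f : x y / x < y} -> avoids213 (map f w) = avoids213 w.
Proof.
move=> fm; elim: w => //= x w ->; congr (_ && _).
by rewrite pairwise_map; apply: eq_pairwise => y z /=; rewrite !fm.
Qed.

(** When q lies above p, no occurrence of 213 can straddle the two parts: its
    first letter would be in q and its last, largest one in 0 :: p. *)
Lemma avoids213_cat0 q p : {in q & p, forall x z, 0 < x /\ z < x} ->
  avoids213 (q ++ 0 :: p) = avoids213 q && avoids213 p.
Proof.
elim: q => [|x q IH] h /=.
  suff -> : pairwise (fun y z => ~~ ((y < 0) && (0 < z))) p by [].
  by elim: p {h} => //= a p ->; rewrite andbT; apply/allP.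
rewrite IH => [|y z yq zp]; last by apply: h; rewrite // inE yq orbT.
rewrite andbA; congr (_ && _ && _).
have xp z : z \in 0 :: p -> x < z = false.
  rewrite inE => /orP[/eqP ->|zp]; first by [].
  have [] := h x z (mem_head _ _) zp; lia.
rewrite pairwise_cat.
have -> : allrel (fun y z => ~~ ((y < x) && (x < z))) q (0 :: p).
  by apply/allrelP => y z _ zp; rewrite xp // andbF.
suff -> : pairwise (fun y z => ~~ ((y < x) && (x < z))) (0 :: p) by rewrite andbT.
have : pairwise (fun _ _ => true) (0 :: p).
  by elim: (0 :: p) => //= a s ->; rewrite andbT; apply/allP.
apply: sub_in_pairwise => //.
by move=> y z _ zp _ /=; rewrite xp ?andbF.
Qed.

(** The letter 0 in the middle plays the part of the 1 in the pattern 213. *)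
Lemma avoids213_split q p : avoids213 (q ++ 0 :: p) ->
  {in q & p, forall x z, 0 < x -> z <= x}.
Proof.
elim: q => //= y q IH /andP[h0 /IH{}IH] x z; rewrite inE.
move=> /orP[/eqP->|/IH h]; last exact: h.
move: h0; rewrite pairwise_cat /= => /and3P[_ _ /andP[/allP h _]] zp y0.
by move: (h z zp) => /=; rewrite y0 /= -leqNgt.
Qed.

Lemma size_glue q p : size (glue q p) = (size q + size p).+1.
Proof. by rewrite /glue size_cat /= !size_map addnS. Qed.

Lemma iota_glue l r :
  perm_eq ([seq l.+1 + x | x <- iota 0 r] ++ 0 :: [seq x.+1 | x <- iota 0 l])
          (iota 0 (r + l).+1).
Proof.
rewrite -iotaDl perm_catC /= perm_cons.
have -> : [seq x.+1 | x <- iota 0 l] = iota 1 l.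
  by rewrite -[in RHS](addn0 1) iotaDl.
by rewrite addn0 -[l.+1]add1n -iotaD addnC.
Qed.

Lemma glue_word q p n l :
  q \in words n -> p \in words l -> glue q p \in words (n + l).+1.
Proof.
move=> qn pl; have sp := size_word pl.
move: qn pl; rewrite !mem_words => /andP[aq eq] /andP[ap ep].
have memq x : x \in q -> x < n by rewrite (perm_mem eq) mem_iota.
have memp x : x \in p -> x < l by rewrite (perm_mem ep) mem_iota.
rewrite /glue avoids213_cat0; last first.
  move=> _ _ /mapP[x xq ->] /mapP[z zp ->]; split; first by lia.
  by have := memp z zp; rewrite -sp => /=; lia.
rewrite !avoids213_map ?aq ?ap /=; [|by move=> x y; lia..].
rewrite sp; apply: perm_trans (iota_glue l n).
by apply: perm_cat; [exact: perm_map|rewrite perm_cons; exact: perm_map].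
Qed.

(** Cut at the letter 0.  As q lies above p, sorting each part and
    concatenating gives an increasing rearrangement of 1, ..., n; this
    identifies the letters of p as the smallest ones. *)
Lemma glue_surj n w : w \in words n.+1 ->
  exists q p, [/\ q \in words (size q), p \in words (size p),
                  size q + size p = n & w = glue q p].
Proof.
rewrite mem_words => /andP[aw ew].
have w0 : 0 \in w by rewrite (perm_mem ew) mem_iota.
have uw : uniq w by rewrite (perm_uniq ew) iota_uniq.
move: ew aw uw; case/splitPr: w0 => q p ew aw uw.
have hqp := avoids213_split aw.
have q0 : 0 \notin q by move: uw; rewrite cat_uniq /= negb_or => /and3P[_ /andP[]].
have p0 : 0 \notin p by move: uw; rewrite cat_uniq /= => /and4P[].
have dis x : x \in q -> x \in p -> False.
  move=> xq xp; move: uw; rewrite cat_uniq /= negb_or.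
  move=> /and3P[_ /andP[_ /hasPn /(_ x xp)]].
  by rewrite /= xq.
have {}hqp : {in q & p, forall x z, 0 < x /\ z < x}.
  move=> x z xq zp; have x0 : 0 < x by case: x xq => [|//]; rewrite (negbTE q0).
  split=> //; have := hqp x z xq zp x0; rewrite leq_eqVlt => /orP[/eqP zx|//].
  by case: (dis x) => //; rewrite -zx.
have epq : perm_eq (p ++ q) (iota 1 n).
  by move: ew; rewrite perm_catC /= perm_cons.
(* Sortedness across the junction is exactly that p lies below q. *)
have e2 : sort leq p ++ sort leq q = iota 1 n.
  apply: (@sorted_eq _ leq).
  - exact: leq_trans.
  - by move=> x y; rewrite -eqn_leq => /eqP.
  - rewrite (sorted_pairwise leq_trans) pairwise_cat -!(sorted_pairwise leq_trans).
    rewrite !sort_sorted ?andbT; [|exact: leq_total..].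
    by apply/allrelP => z x; rewrite !mem_sort => zp xq; have [] := hqp x z xq zp; lia.
  - exact: (iota_sorted 1 n).
  - by apply: perm_trans epq; apply: perm_cat; rewrite perm_sort.
have sz : size q + size p = n.
  by have := congr1 size e2; rewrite size_cat !size_sort size_iota addnC.
move: e2; rewrite -{1}sz addnC iotaD => /eqP.
rewrite eqseq_cat ?size_sort ?size_iota // => /andP[/eqP sp /eqP sq].
have ep : perm_eq p (iota 1 (size p)) by rewrite -sp perm_sym perm_sort.
have eq : perm_eq q (iota (1 + size p) (size q)) by rewrite -sq perm_sym perm_sort.
pose q' := [seq x - (size p).+1 | x <- q]; pose p' := [seq x.-1 | x <- p].
have qq : q = [seq (size p).+1 + x | x <- q'].
  rewrite -map_comp -[LHS]map_id; apply/eq_in_map => x.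
  by rewrite (perm_mem eq) mem_iota /= => h; lia.
have pp : p = [seq x.+1 | x <- p'].
  rewrite -map_comp -[LHS]map_id; apply/eq_in_map => x.
  by rewrite (perm_mem ep) mem_iota /= => h; lia.
have sp' : size p' = size p by rewrite size_map.
have sq' : size q' = size q by rewrite size_map.
move: aw; rewrite (avoids213_cat0 hqp) => /andP[aq ap].
exists q', p'; split; rewrite ?sp' ?sq' //; last by rewrite /glue sp' -qq -pp.
- rewrite mem_words; apply/andP; split.
    by move: aq; rewrite {1}qq avoids213_map // => x y; lia.
  have : perm_eq q' [seq x - (size p).+1 | x <- iota (1 + size p) (size q)].
    exact: perm_map.
  rewrite -{1}(addn0 (1 + _)) iotaDl -map_comp (eq_map (g := id)) ?map_id //.
  by move=> x /=; lia.
- rewrite mem_words; apply/andP; split.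
    by move: ap; rewrite {1}pp avoids213_map // => x y; lia.
  have : perm_eq p' [seq x.-1 | x <- iota 1 (size p)] by exact: perm_map.
  by rewrite -{1}(addn0 1) iotaDl -map_comp (eq_map (g := id)) ?map_id.
Qed.

(** The position of 0 in the glued word recovers where to cut. *)
Lemma glue_inj q p q' p' : glue q p = glue q' p' -> q = q' /\ p = p'.
Proof.
move=> e.
have ix a b : index 0 (glue a b) = size a.
  rewrite /glue index_cat size_map /= addn0; case: ifP => // /mapP[x _]; lia.
have sq : size q = size q' by rewrite -(ix q p) e ix.
have sp : size p = size p' by have := congr1 size e; rewrite !size_glue sq; lia.
move: e => /eqP; rewrite /glue eqseq_cat ?size_map // sp => /andP[/eqP e1 /eqP[e2]].
split; [apply: inj_map e1|apply: inj_map e2] => x y; lia.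
Qed.

(** The bijection between words and pairs of shorter words, in the form in
    which every count below uses it. *)
Lemma sum_words (f : seq nat -> nat) n :
  \sum_(w <- words n.+1) f w =
  \sum_(l < n.+1) \sum_(q <- words (n - l)) \sum_(p <- words l) f (glue q p).
Proof.
pose ww l := [seq (q, p) | q <- words (n - l), p <- words l].
have mww l q p : ((q, p) \in ww l) = (q \in words (n - l)) && (p \in words l).
  apply/allpairsP/andP => [[[a b] /= [? ? [-> ->]]]//|[? ?]]; by exists (q, p).
have e : perm_eq (words n.+1) [seq glue x.1 x.2 | l <- iota 0 n.+1, x <- ww l].
  apply: uniq_perm; first exact: uniq_words.
    apply: allpairs_uniq_dep; first exact: iota_uniq.
      move=> l _; apply: allpairs_uniq; [exact: uniq_words..|].
      by move=> [? ?] [? ?] _ _ [-> ->].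
    move=> [l [q p]] [l' [q' p']].
    move=> /allpairsPdep[x [y [_ hy [-> ->]]]]
      /allpairsPdep[x' [y' [_ hy' [-> ->]]]] /=.
    move: y y' hy hy' => [a b] [a' b']; rewrite !mww /=.
    move=> /andP[_ /size_word s1] /andP[_ /size_word s2] /glue_inj[-> e].
    by rewrite -s1 -s2 e.
  move=> w; apply/idP/idP.
    move=> /glue_surj[q [p [hq hp sz ->]]].
    apply/allpairsPdep; exists (size p), (q, p); rewrite mww mem_iota /=; split=> //.
      by move: sz => /=; lia.
    by rewrite hp andbT -sz addnK.
  move=> /allpairsPdep[l [[q p] [hl]]]; rewrite mww mem_iota in hl * => /andP[hq hp] ->.
  have -> : n.+1 = ((n - l) + l).+1 by rewrite subnK //; lia.
  exact: glue_word.
rewrite (perm_big _ e) big_allpairs_dep [iota 0 _](_ : _ = index_iota 0 n.+1); last first.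
  by rewrite /index_iota subn0.
by rewrite big_mkord; apply: eq_bigr => l _; rewrite big_allpairs.
Qed.

(** * Catalan and ballot numbers *)

Definition catalan (n : nat) : nat := size (words n).

Lemma catalan0 : catalan 0 = 1.
Proof. by []. Qed.

(** Segner's recurrence. *)
Lemma catalanS n : catalan n.+1 = \sum_(l < n.+1) catalan l * catalan (n - l).
Proof.
rewrite /catalan -sum1_size sum_words; apply: eq_bigr => l _.
by rewrite -!(sum1_size (words _)) big_distrlr /= exchange_big.
Qed.

(** The coefficient of x^n in (x c(x))^k, where c is the generating function of
    the Catalan numbers; each step multiplies by one more factor x c(x). *)
Fixpoint ballot (k n : nat) : nat :=
  if k is k'.+1 then \sum_(l < n) catalan l * ballot k' (n - l.+1) else n == 0.
Arguments ballot : simpl never.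

Lemma ballotS k n : ballot k.+1 n = \sum_(l < n) catalan l * ballot k (n - l.+1).
Proof. by []. Qed.

Lemma ballot1 n : ballot 1 n.+1 = catalan n.
Proof.
rewrite ballotS big_ord_recr /= subnn [ballot 0 0]/= muln1 big1 ?add0n // => i _.
by rewrite (_ : n.+1 - i.+1 = (n - i.+1).+1) ?muln0 //; have := ltn_ord i; lia.
Qed.

(** The coefficient form of u^(k+1) = x u^k + u^(k+2), where u = x c(x) solves
    u = x + u^2. *)
Lemma ballot_rec k n : ballot k.+1 n.+1 = ballot k n + ballot k.+2 n.+1.
Proof.
elim: k n => [|k IH] n.
  rewrite ballot1 ballotS big_ord_recr /= subnn [ballot 1 0]big_ord0 muln0 addn0.
  case: n => [|n]; first by rewrite big_ord0.
  rewrite catalanS; apply: eq_bigr => l _.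
  by rewrite subSS subSn -1?ltnS // ballot1.
rewrite ballotS big_ord_recr /= subnn [ballot k.+1 0]big_ord0 muln0 addn0.
rewrite [ballot k.+3 _]ballotS big_ord_recr /= subnn [ballot k.+2 0]big_ord0 muln0 addn0.
rewrite ballotS -big_split; apply: eq_bigr => l _ /=.
have -> : n.+1 - l.+1 = (n - l.+1).+1 by have := ltn_ord l; lia.
by rewrite -mulnDr -IH.
Qed.

Lemma ballot_eq0 k n : n < k -> ballot k n = 0.
Proof.
elim: k n => // k IH n nk; rewrite ballotS big1 // => l _.
by rewrite IH ?muln0 //; have := ltn_ord l; lia.
Qed.

Lemma ballot_diag k : ballot k k = 1.
Proof. by elim: k => // k IH; rewrite ballot_rec IH ballot_eq0. Qed.

(** The reflection principle: a ballot number is a difference of two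
    neighbouring binomial coefficients.  By Pascal's rule this difference obeys
    the recurrence [ballot_rec]. *)
Lemma ballot_bin k m :
  ballot k (k + m.+1) + 'C(k + m.*2.+1, m) = 'C(k + m.*2.+1, m.+1).
Proof.
elim: m k => [|m IH].
  elim=> [|k IH]; first by [].
  rewrite addSn ballot_rec; move: IH.
  by rewrite !bin0 !bin1 !addn1 ballot_diag; lia.
elim=> [|k IHk].
  rewrite add0n /= add0n -[RHS]bin_sub; last by lia.
  by congr 'C(_, _); lia.
rewrite addSn ballot_rec; move: IHk (IH k.+2).
rewrite (_ : k.+2 + m.+1 = (k + m.+2).+1); last by lia.
rewrite (_ : k.+2 + m.*2.+1 = k + m.+1.*2.+1); last by lia.
rewrite (_ : k.+1 + m.+1.*2.+1 = (k + m.+1.*2.+1).+1); last by lia.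
rewrite !binS; lia.
Qed.

Lemma ballotE k m : (k + m) * ballot k (k + m) = k * 'C(k + m.*2 - 1, m).
Proof.
case: m => [|m]; first by rewrite addn0 ballot_diag bin0.
have h := ballot_bin k m; have := mul_bin_left (k + m.*2.+1) m.
rewrite (_ : k + m.+1.*2 - 1 = k + m.*2.+1); last by lia.
rewrite (_ : k + m.*2.+1 - m = k + m.+1); last by lia.
nia.
Qed.

Lemma catalan_gt0 n : 0 < catalan n.
Proof.
elim/ltn_ind: n => -[|n] IH; first by rewrite catalan0.
by rewrite catalanS big_ord_recl catalan0 mul1n subn0 addn_gt0 IH.
Qed.

Lemma catalan_bin n : n.+1 * catalan n = 'C(n.*2, n).
Proof.
by have := ballotE 1 n; rewrite add1n ballot1 mul1n => ->; congr 'C(_, _); lia.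
Qed.

(** This exact ratio is the only asymptotic information on the Catalan numbers
    that the limits require. *)
Lemma catalan_ratio n : n.+2 * catalan n.+1 = (n.*2.+1).*2 * catalan n.
Proof.
have h0 := catalan_bin n; have h1 := catalan_bin n.+1.
have h2 := mul_bin_diag n.*2.+2 n; have h3 := mul_bin_diag n.*2.+1 n.
have h4 : 'C(n.*2.+1, n) = 'C(n.*2.+1, n.+1).
  by rewrite -[RHS]bin_sub; [congr 'C(_, _); lia|lia].
move: h1 h2 h3; rewrite doubleS /= h4 -h0 => h1 h2 h3.
apply/eqP; rewrite -(eqn_pmul2l (ltn0Sn n)); apply/eqP; nia.
Qed.

(** * Counting words through prescribed points *)

(** The coefficient of x^a y^b in 4uv / (1 - 4uv), with u = x c(x) and
    v = y c(y); powers k > b do not contribute.  It is 4^(a+b) rho(a,b). *)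
Definition rho_num (a b : nat) : nat :=
  \sum_(k < b) 4 ^ k.+1 * ballot k.+1 a * ballot k.+1 b.

Lemma rho_num_widen M a b : b <= M ->
  rho_num a b = \sum_(k < M) 4 ^ k.+1 * ballot k.+1 a * ballot k.+1 b.
Proof.
move=> bM; rewrite /rho_num
  (big_ord_widen M (fun k => 4 ^ k.+1 * ballot k.+1 a * ballot k.+1 b) bM).
rewrite [RHS](bigID (fun k : 'I_M => k < b)) /=.
rewrite [X in _ + X]big1 ?addn0 // => k; rewrite -leqNgt => bk.
by rewrite (@ballot_eq0 k.+1 b) ?muln0.
Qed.

(** The generating function r = 4uv/(1 - 4uv) satisfies r = v r + 4uy r + 4uy,
    because y = v - v^2.  On coefficients: split one of the two ballot factors
    by [ballot_rec]; the part v^(k+1) gives the convolution in b, the part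
    y v^(k-1) the convolution in a, and its term k = 1 the inhomogeneous one. *)
Lemma rho_num_rec a b : 0 < a ->
  rho_num a b.+1 =
    \sum_(l < b.+1) catalan l * rho_num a (b.+1 - l.+1)
    + (\sum_(r < a) 4 * catalan r * rho_num (a - r.+1) b
       + (b == 0) * (4 * catalan a.-1)).
Proof.
move=> a0; rewrite {1}/rho_num.
under eq_bigr => k _ do rewrite ballot_rec mulnDr.
rewrite big_split /= addnC; congr addn.
  under [RHS]eq_bigr => l _ do
    rewrite (@rho_num_widen b.+1) ?leq_subr // big_distrr.
  rewrite exchange_big; apply: eq_bigr => k _ /=.
  rewrite [ballot k.+2 _]ballotS big_distrr; apply: eq_bigr => l _ /=.
  by rewrite subSS mulnCA.
rewrite big_ord_recl addnC; congr addn; last first.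
  by rewrite expn1 -{1}(prednK a0) ballot1 mulnC.
under [RHS]eq_bigr => r _ do rewrite /rho_num big_distrr.
rewrite exchange_big; apply: eq_bigr => k _ /=.
rewrite [ballot _ a]ballotS -mulnA [X in _ * X]mulnC !mulnA big_distrr /=.
by apply: eq_bigr => r _; rewrite expnS /bump add1n; lia.
Qed.

(** Places and letters of a point are 1-based, so that a point with a null
    coordinate is never hit.  Thanks to this the truncated subtractions in the
    decomposition below need no side conditions. *)
Definition hits_point (w : seq nat) (c : nat * nat) : bool :=
  (0 < c.1 <= size w) && ((nth 0 w c.1.-1).+1 == c.2).

Definition translate (d c : nat * nat) : nat * nat := (d.1 + c.1, d.2 + c.2).

(** A chain is given by the increments (a_1, b_1), (a_2, b_2), ... between
    successive points; this recovers the points (A_m, B_m). *)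
Fixpoint points (ds : seq (nat * nat)) : seq (nat * nat) :=
  if ds is d :: ds' then d :: [seq translate d c | c <- points ds'] else [::].

Definition hits (ds : seq (nat * nat)) (w : seq nat) : bool :=
  all (hits_point w) (points ds).

Definition hit_count (n : nat) (ds : seq (nat * nat)) : nat :=
  \sum_(w <- words n) hits ds w.

Definition pos_pair (c : nat * nat) : bool := (0 < c.1) && (0 < c.2).

Lemma points_gt0 ds : all pos_pair ds -> all pos_pair (points ds).
Proof.
elim: ds => //= d ds IH /andP[d0 /IH h]; rewrite d0 /= all_map.
apply: sub_all h => c; rewrite /pos_pair /=; move: d0; rewrite /pos_pair; lia.
Qed.

(** At most one of the three alternatives can hold, according to whether the
    place A falls in q, on the letter 0, or in p; the others fail because a
    truncated coordinate is 0 or the place exceeds the size of q. *)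
Lemma hits_point_glue q p A B :
  hits_point (glue q p) (A, B) =
  [|| hits_point q (A, B - (size p).+1),
      (A == (size q).+1) && (B == 1)
    | hits_point p (A - (size q).+1, B.-1)].
Proof.
rewrite /hits_point /= size_glue /glue nth_cat size_map.
case: A => [|A] /=; first by [].
rewrite subSS subn_gt0 eqSS.
case: (ltngtP A (size q)) => Aq /=.
- rewrite (nth_map 0) // orbF.
  have -> : A < (size q + size p).+1 by lia.
  by rewrite /=; apply/eqP/eqP; lia.
- have -> : A - size q = (A - (size q).+1).+1 by lia.
  rewrite /=; case: (ltnP (A - (size q).+1) (size p)) => Ap.
    have -> : A < (size q + size p).+1 by lia.
    by rewrite (nth_map 0) //=; apply/eqP/eqP; lia.
  by have -> : A < (size q + size p).+1 = false by lia.
- rewrite Aq subnn /= orbF eq_sym.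
  by have -> : size q < (size q + size p).+1 by lia.
Qed.

Lemma hits_point_le n w c : w \in words n -> hits_point w c -> c.2 <= n.
Proof.
rewrite mem_words => /andP[_ ew] /andP[/andP[c0 cs] /eqP <-].
have : nth 0 w c.1.-1 \in w by rewrite mem_nth // prednK.
by rewrite (perm_mem ew) mem_iota.
Qed.

(** The first point decides where the whole chain lies: if it is in q, the
    later letters are larger still, hence too large for p; if it is at or
    beyond 0, the later places are in p. *)
Lemma hits_glue q p n l a b ds :
  q \in words n -> p \in words l -> all pos_pair ((a, b) :: ds) ->
  (hits ((a, b) :: ds) (glue q p) : nat) =
  hits ((a, b - l.+1) :: ds) q
  + (hits ((a - n.+1, b.-1) :: ds) p
     + ((a == n.+1) && (b == 1)) * hits ds p).
Proof.
move=> qn pl /= /andP[/andP[/= a0 b0] /points_gt0 /allP dpos].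
have sq := size_word qn; have sp := size_word pl.
have hp c : hits_point p c -> c.2 <= l by exact: hits_point_le.
rewrite /hits /= hits_point_glue sq sp !all_map.
have qF A B : n < A -> hits_point q (A, B) = false.
  by move=> nA; rewrite /hits_point /= sq; lia.
have p0 B : hits_point p (0, B) = false by [].
have z0 w A : hits_point w (A, 0) = false by rewrite /hits_point /= andbF.
case: (ltngtP a n.+1) => an /=.
- have -> : a - n.+1 = 0 by lia.
  rewrite p0 /= !orbF addn0; case: (ltnP l.+1 b) => lb; last first.
    by have -> : b - l.+1 = 0 by [lia]; rewrite z0.
  congr (nat_of_bool (_ && _)); apply: eq_in_all => -[A B] /dpos /andP[/= A0 B0].
  rewrite hits_point_glue sq sp.
  have -> : (b + B == 1) = false by lia.
  have -> : hits_point p (a + A - n.+1, (b + B).-1) = false.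
    by apply/negP => /hp /=; lia.
  by rewrite andbF !orbF /translate /= addnBAC // ltnW.
- rewrite (qF _ _ (ltnW an)) /= add0n mul0n addn0; case: (ltnP 1 b) => b1; last first.
    by have -> : b.-1 = 0 by [lia]; rewrite z0.
  congr (nat_of_bool (_ && _)); apply: eq_in_all => -[A B] /dpos /andP[/= A0 B0].
  rewrite hits_point_glue sq sp qF /=; last by lia.
  have -> : (a + A == n.+1) = false by lia.
  rewrite /translate /= addnBAC ?(ltnW an) //.
  by have -> : (b + B).-1 = b.-1 + B by lia.
- rewrite an qF // subnn p0 /= !add0n orbF; case: eqP => [->|_] //=.
  rewrite mul1n; congr nat_of_bool; apply: eq_in_all => -[A B] /dpos /andP[/= A0 B0].
  rewrite hits_point_glue sq sp qF /=; last by lia.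
  have -> : (n.+1 + A == n.+1) = false by lia.
  by rewrite /= addKn.
Qed.

Lemma hit_count_fst0 n b ds : hit_count n ((0, b) :: ds) = 0.
Proof. by rewrite /hit_count big1. Qed.

Lemma hit_count_snd0 n a ds : hit_count n ((a, 0) :: ds) = 0.
Proof. by rewrite /hit_count big1 // => w _; rewrite /hits /= /hits_point andbF. Qed.

Lemma hit_count_nil n : hit_count n [::] = catalan n.
Proof. by rewrite /hit_count /catalan -sum1_size. Qed.

(** Summing [hits_glue] over all decompositions.  Terms in which the part not
    containing the first point is too long vanish, so the number of terms
    does not depend on n. *)
Lemma hit_count_rec n a b ds :
  all pos_pair ((a, b.+1) :: ds) -> a <= n.+1 -> b <= n ->
  hit_count n.+1 ((a, b.+1) :: ds) =
    \sum_(l < b.+1) catalan l * hit_count (n.+1 - l.+1) ((a, b.+1 - l.+1) :: ds)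
    + (\sum_(r < a) catalan r * hit_count (n.+1 - r.+1) ((a - r.+1, b) :: ds)
       + (b == 0) * (catalan a.-1 * hit_count (n.+1 - a) ds)).
Proof.
move=> dpos an bn; rewrite {1}/hit_count sum_words.
(* The part of the word that contains no point contributes a Catalan factor. *)
have sumq A (f : seq nat -> nat) l :
   \sum_(q <- words A) \sum_(p <- words l) f q = catalan l * \sum_(q <- words A) f q.
  rewrite big_distrr /=; apply: eq_bigr => q _.
  by rewrite big_const_seq count_predT iter_addn_0 mulnC.
have sump A (f : seq nat -> nat) l :
   \sum_(q <- words A) \sum_(p <- words l) f p = catalan A * \sum_(p <- words l) f p.
  by rewrite big_const_seq count_predT iter_addn_0 mulnC.
transitivity (\sum_(l < n.+1)
  (catalan l * hit_count (n - l) ((a, b.+1 - l.+1) :: ds) +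
   (catalan (n - l) * hit_count l ((a - (n - l).+1, b) :: ds)
   + ((a == (n - l).+1) && (b == 0)) * (catalan (n - l) * hit_count l ds)))).
  apply: eq_bigr => l _; rewrite /hit_count -sumq -!sump big_distrr -!big_split /=.
  apply: eq_big_seq => q hq; rewrite big_distrr -!big_split /=.
  by apply: eq_big_seq => p hp; rewrite /= (hits_glue hq hp dpos).
rewrite !big_split /=; congr addn.
  rewrite [RHS](big_ord_widen n.+1
    (fun l => catalan l * hit_count (n - l) ((a, b.+1 - l.+1) :: ds))) //.
  rewrite [LHS](bigID (fun l : 'I_n.+1 => l < b.+1)) /=.
  rewrite [X in _ + X]big1 ?addn0 // => l.
  rewrite -leqNgt => bl; have -> : b.+1 - l.+1 = 0 by lia.
  by rewrite hit_count_snd0 muln0.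
rewrite [X in X + _](reindex_inj rev_ord_inj) [X in _ + X](reindex_inj rev_ord_inj) /=.
have nn (r : 'I_n.+1) : n - (n - r) = r by have := ltn_ord r; lia.
congr addn.
  rewrite [RHS](big_ord_widen n.+1
    (fun r => catalan r * hit_count (n - r) ((a - r.+1, b) :: ds))) //.
  rewrite [LHS](bigID (fun l : 'I_n.+1 => l < a)) /=.
  rewrite [X in _ + X]big1 ?addn0 => [|l].
    by apply: eq_bigr => r _; rewrite subSS nn.
  rewrite -leqNgt subSS nn => bl; have -> : a - l.+1 = 0 by lia.
  by rewrite hit_count_fst0 muln0.
move: dpos => /= /andP[/andP[/= a0 _] _].
have ia : a.-1 < n.+1 by lia.
rewrite (bigD1 (Ordinal ia)) //= subSS big1 ?addn0 => [|r].
  rewrite (nn (Ordinal ia)) /= prednK // eqxx.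
  by have -> : n.+1 - a = n - a.-1 by lia.
rewrite -val_eqE /= => ra; rewrite subSS nn.
by have -> : a == r.+1 = false by [lia]; rewrite mul0n.
Qed.

(** * Permutations as words *)

(** The one-line notation from right to left, with 0-based letters. *)
Definition word (N : nat) (s : 'S_N) : seq nat :=
  [seq val (s (rev_ord i)) | i <- enum 'I_N].

Lemma size_word_perm N (s : 'S_N) : size (word s) = N.
Proof. by rewrite size_map size_enum_ord. Qed.

Lemma nth_word N (s : 'S_N) (i : 'I_N) : nth 0 (word s) i = s (rev_ord i).
Proof.
by rewrite (nth_map i) ?size_enum_ord ?ltn_ord // nth_ord_enum.
Qed.

Lemma avoids_word N (s : 'S_N) : avoids213 (word s) = avoids312 s.
Proof.
apply/avoids213P/forallP => [h i1|h i j k ij jk].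
  apply/forallP => i2; apply/forallP => i3; apply/negP => /and4P[i12 i23 s31 s23].
  have := h (rev_ord i3) (rev_ord i2) (rev_ord i1).
  rewrite !nth_word !rev_ordK s31 s23 size_word_perm ltn_ord.
  suff [-> ->] : rev_ord i3 < rev_ord i2 /\ rev_ord i2 < rev_ord i1
    by move/(_ isT isT isT).
  by have := ltn_ord i3; rewrite /=; lia.
rewrite size_word_perm => kN.
have jN := ltn_trans jk kN; have iN := ltn_trans ij jN.
have /forallP /(_ (rev_ord (Ordinal jN))) /forallP /(_ (rev_ord (Ordinal iN))) :=
  h (rev_ord (Ordinal kN)).
rewrite -(nth_word s (Ordinal kN)) -(nth_word s (Ordinal jN))
  -(nth_word s (Ordinal iN)) /=.
rewrite !ltn_sub2l ?(leq_ltn_trans ij jN) ?(leq_ltn_trans jk kN) //= => H.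
by rewrite andbC.
Qed.

Lemma word_inj N : injective (@word N).
Proof.
move=> s t e; apply/permP => i; apply: val_inj.
by rewrite -(rev_ordK i) /= -!nth_word e.
Qed.

Lemma perm_eq_word N (s : 'S_N) : perm_eq (word s) (iota 0 N).
Proof.
apply: uniq_perm; last 1 first.
- move=> x; rewrite mem_iota /= add0n; apply/mapP/idP => [[i _ ->]|xN].
    exact: ltn_ord.
  exists (rev_ord ((s^-1)%g (Ordinal xN))); first by rewrite mem_enum.
  by rewrite rev_ordK permKV.
- rewrite map_inj_uniq ?enum_uniq // => i j /val_inj /perm_inj; exact: rev_ord_inj.
- exact: iota_uniq.
Qed.

Lemma word_surj N w : perm_eq w (iota 0 N) -> exists s : 'S_N, word s = w.
Proof.
move=> ew; have sw : size w = N by rewrite (perm_size ew) size_iota.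
have lt (i : 'I_N) : nth 0 w (rev_ord i) < N.
  have : nth 0 w (rev_ord i) \in w by rewrite mem_nth // sw ltn_ord.
  by rewrite (perm_mem ew) mem_iota.
have inj : injective (fun i => Ordinal (lt i)).
  move=> i j /(congr1 val) /= /eqP.
  rewrite nth_uniq ?sw ?(perm_uniq ew) ?iota_uniq //; last 2 first.
  - by have := ltn_ord i; lia.
  - by have := ltn_ord j; lia.
  move=> /eqP e; apply: val_inj; have := ltn_ord i; have := ltn_ord j.
  by move: e => /=; lia.
exists (perm inj); apply: (@eq_from_nth _ 0); first by rewrite size_word_perm sw.
rewrite size_word_perm => i iN.
rewrite (nth_word _ (Ordinal iN)) permE /=; congr (nth 0 w _); lia.
Qed.

Lemma card_S312 N (P : pred (seq nat)) :
  #|[set s in S312 N | P (word s)]| = \sum_(w <- words N) P w.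
Proof.
set E := [set s in S312 N | P (word s)].
have e : perm_eq [seq word s | s <- enum E] [seq w <- words N | P w].
  apply: uniq_perm.
  - by rewrite map_inj_uniq ?enum_uniq //; exact: word_inj.
  - exact/filter_uniq/uniq_words.
  move=> w; rewrite mem_filter mem_words; apply/mapP/idP.
    by move=> [s]; rewrite mem_enum !inE => /andP[a p] ->; rewrite p avoids_word a perm_eq_word.
  move=> /and3P[p a /word_surj[s ws]]; exists s => //.
  by rewrite mem_enum !inE -avoids_word ws a p.
have := perm_size e; rewrite size_map -cardE => ->.
by rewrite size_filter -sum1_count big_mkcond.
Qed.

Lemma card_S312_catalan N : #|S312 N| = catalan N.
Proof.
rewrite /catalan -sum1_size; have <- := @card_S312 N predT.
by apply: eq_card => s; rewrite !inE andbT.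
Qed.

Lemma takes_word N (s : 'S_N) A B : 0 < A <= N ->
  takes s (N - A + 1) B = hits_point (word s) (A, B).
Proof.
move=> /andP[A0 AN]; rewrite /hits_point size_word_perm A0 AN /=.
have iN : A.-1 < N by lia.
rewrite (nth_word s (Ordinal iN)); apply/existsP/idP => [[x /andP[/eqP ex]]|h].
  by have -> : x = rev_ord (Ordinal iN) by apply: val_inj => /=; lia.
by exists (rev_ord (Ordinal iN)); rewrite h andbT /=; apply/eqP; lia.
Qed.

Lemma psum_lift k (a : 'I_k.+1 -> nat) (m : 'I_k) :
  psum a (lift ord0 m) = a ord0 + psum (fun l => a (lift ord0 l)) m.
Proof.
rewrite /psum big_mkcond big_ord_recl /=; congr addn.
by rewrite [RHS]big_mkcond; apply: eq_bigr => l _; rewrite /bump !add1n ltnS.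
Qed.

Lemma psum0 k (a : 'I_k.+1 -> nat) : psum a ord0 = a ord0.
Proof.
by rewrite /psum big_mkcond big_ord_recl /= big1 ?addn0.
Qed.

Lemma points_psum k (a b : 'I_k -> nat) :
  points [seq (a l, b l) | l <- enum 'I_k] =
  [seq (psum a m, psum b m) | m <- enum 'I_k].
Proof.
elim: k a b => [|k IH] a b; first by rewrite !enum_ord0.
rewrite !enum_ordSl /= !psum0; congr (_ :: _).
have -> : [seq (a l, b l) | l <- [seq lift ord0 i | i <- enum 'I_k]] =
          [seq (a (lift ord0 l), b (lift ord0 l)) | l <- enum 'I_k].
  by rewrite -map_comp.
rewrite IH -!map_comp; apply: eq_map => m /=.
by rewrite /translate /= !psum_lift.
Qed.

(** The bound on N keeps all places inside the word; otherwise the truncated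
    position N - A + 1 would be 1 instead of being out of range. *)
Lemma card_Sdesc N k (a b : 'I_k -> nat) :
  (forall m, 0 < a m) -> \sum_l a l <= N ->
  #|Sdesc N (fun j : 'I_k => N - psum a (rev_ord j) + 1)
            (fun j : 'I_k => psum b (rev_ord j))| =
  hit_count N [seq (a l, b l) | l <- enum 'I_k].
Proof.
move=> a0 aN; rewrite /hit_count -card_S312; apply: eq_card => s.
rewrite !inE; congr (_ && _); rewrite /hits points_psum all_map.
have am (m : 'I_k) : 0 < psum a m <= N.
  apply/andP; split; first by rewrite /psum (bigD1 m) //= addn_gt0 a0.
  apply: leq_trans aN; rewrite [X in _ <= X](bigID (fun l : 'I_k => l <= m)) /=.
  exact: leq_addr.
apply/forallP/allP => [h m _ | h j] /=.
  by have := h (rev_ord m); rewrite rev_ordK takes_word.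
by rewrite takes_word //; apply: h; rewrite mem_enum.
Qed.

Lemma Spoint_Sdesc N a b :
  Spoint N (N - a + 1) b =
  Sdesc N (fun j : 'I_1 => N - psum (fun _ => a) (rev_ord j) + 1)
          (fun j : 'I_1 => psum (fun _ => b) (rev_ord j)).
Proof.
apply/setP => s; rewrite !inE; congr (_ && _).
have e c (j : 'I_1) : psum (fun _ => c) (rev_ord j) = c by rewrite ord1 psum0.
apply/idP/forallP => [h j|/(_ ord0)]; by rewrite !e.
Qed.

(** * Limits with error O(1/N) *)

Local Open Scope classical_set_scope.
Local Open Scope ring_scope.

(** The shape in which ballot numbers occur in rho. *)
Lemma ballot_binE K n : (0 < K <= n)%N ->
  (n * ballot K n = K * 'C(2 * n - K - 1, n - 1))%N.
Proof.
move=> /andP[K0 Kn]; have := ballotE K (n - K); rewrite subnKC // => ->.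
congr muln; rewrite -[RHS]bin_sub; last by lia.
by congr 'C(_, _); lia.
Qed.

(** The closed form of rho as a sum of products of ballot numbers; a null
    coordinate gives 0, in agreement with the counts. *)
Definition rho_ballot (R : realType) (c : nat * nat) : R :=
  (rho_num c.1 c.2)%:R / 4 ^+ (c.1 + c.2).

(** Substitute k = b - i0 + 1.  Each factor (b - i0 + 1) of the square completes
    one binomial coefficient to a ballot number, and the denominators a and b
    are those of the ballot formula.  The indices i0 <= b - a omitted from rho
    have k > a, where the ballot number vanishes. *)
Lemma rho_ballotE (R : realType) a b : (0 < a)%N -> (0 < b)%N ->
  rho R a b = rho_ballot R (a, b).
Proof.
move=> a0 b0; rewrite /rho_ballot /= /rho_num -(big_mkord xpredT
   (fun k => 4 ^ k.+1 * ballot k.+1 a * ballot k.+1 b)%N).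
rewrite big_nat_rev /= natr_sum mulr_suml.
rewrite -(big_add1 _ _ 0 b.+1 xpredT
  (fun i => (4 ^ (0 + b - i).+1 * ballot (0 + b - i).+1 a
             * ballot (0 + b - i).+1 b)%:R / 4 ^+ (a + b) : R)).
rewrite /rho (@big_cat_nat _ _ _ (maxn 1 (b - a + 1)) 1) /=; [|lia..].
rewrite [X in _ = X + _]big_nat [X in _ = X + _]big1 ?add0r => [|i hi]; last first.
  by rewrite (@ballot_eq0 _ a) ?muln0 ?mul0n ?mul0r //; lia.
apply: eq_big_nat => i hi.
have ha := @ballot_binE (b - i).+1 a ltac:(lia).
have hb := @ballot_binE (b - i).+1 b ltac:(lia).
rewrite add0n (_ : i + 2 * (a - 1) - b = 2 * a - (b - i).+1 - 1)%N; last by lia.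
rewrite (_ : i + b - 2 = 2 * b - (b - i).+1 - 1)%N; last by lia.
rewrite (_ : a + b = (i + a - 1) + (b - i).+1)%N; last by lia.
rewrite addn1 exprD !natrM !natrX.
move: ha hb => /(congr1 (fun x => x%:R : R)) + /(congr1 (fun x => x%:R : R)).
rewrite !natrM => ha hb.
have a1 : a%:R != 0 :> R by rewrite pnatr_eq0 -lt0n.
have b1 : b%:R != 0 :> R by rewrite pnatr_eq0 -lt0n.
have p4 k : 4 ^+ k != 0 :> R by rewrite expf_neq0 // pnatr_eq0.
transitivity (((b - i).+1%:R * 'C(2 * a - (b - i).+1 - 1, a - 1)%:R)
  * ((b - i).+1%:R * 'C(2 * b - (b - i).+1 - 1, b - 1)%:R)
  / (b%:R * a%:R * 4 ^+ (i + a - 1)) : R); first by field; rewrite p4 a1 b1.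
by rewrite -ha -hb; field; rewrite !p4 a1 b1.
Qed.

Lemma rho_ballot_gt0 (R : realType) c : pos_pair c -> 0 < rho_ballot R c.
Proof.
case: c => a b /andP[/= a0 b0]; rewrite /rho_ballot divr_gt0 ?exprn_gt0 // ltr0n.
case: b b0 => // b _; case: a a0 => // a _.
by rewrite /rho_num big_ord_recl !ballot1 addn_gt0 !muln_gt0 !catalan_gt0.
Qed.

Section Rate.
Variable R : realType.
Implicit Types (u v : nat -> R) (l m : R).

(** That is, u N = l + O(1/N).  Using N + 1 avoids the inverse of 0. *)
Definition rate u l := exists K N0,
  forall N, (N0 <= N)%N -> `|u N - l| <= K / N.+1%:R.

Lemma rate_cst l : rate (fun _ => l) l.
Proof. by exists 0, 0%N => N _; rewrite subrr normr0 mul0r. Qed.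

Lemma rate_ext N0 u v l :
  (forall N, (N0 <= N)%N -> u N = v N) -> rate u l -> rate v l.
Proof.
move=> uv [K [N1 h]]; exists K, (maxn N0 N1) => N; rewrite geq_max => /andP[n0 n1].
by rewrite -uv // h.
Qed.

Lemma rate_add u v l m : rate u l -> rate v m -> rate (fun N => u N + v N) (l + m).
Proof.
move=> [K [N0 hu]] [L [N1 hv]]; exists (K + L), (maxn N0 N1) => N.
rewrite geq_max => /andP[/hu n0 /hv n1].
rewrite opprD addrACA mulrDl; apply: le_trans (ler_normD _ _) _; exact: lerD.
Qed.

(** From u v - l m = (u - l) v + l (v - m), the sequence v being bounded. *)
Lemma rate_mul u v l m : rate u l -> rate v m -> rate (fun N => u N * v N) (l * m).
Proof.
move=> [K [N0 hu]] [L [N1 hv]]; exists (K * (`|m| + L) + `|l| * L), (maxn N0 N1) => N.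
rewrite geq_max => /andP[/hu n0 /hv n1].
have N1' : (1 : R) <= N.+1%:R by rewrite ler1n.
have L0 : 0 <= L.
  have := le_trans (normr_ge0 _) n1; by rewrite pmulr_lge0 // invr_gt0 ltr0n.
have vb : `|v N| <= `|m| + L.
  rewrite -[v N](subrK m) addrC; apply: le_trans (ler_normD _ _) _; rewrite lerD2l.
  by apply: le_trans n1 _; rewrite ler_pdivrMr ?ltr0n // ler_peMr.
have -> : u N * v N - l * m = (u N - l) * v N + l * (v N - m) by ring.
apply: le_trans (ler_normD _ _) _; rewrite !normrM mulrDl.
rewrite [K * _ / _]mulrAC -[_ * L / _]mulrA; apply: lerD.
  by apply: ler_pM.
by apply: ler_wpM2l.
Qed.

Lemma rate_sum n (u : 'I_n -> nat -> R) (l : 'I_n -> R) :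
  (forall i, rate (u i) (l i)) -> rate (fun N => \sum_i u i N) (\sum_i l i).
Proof.
elim: n u l => [|n IH] u l h.
  rewrite big_ord0; apply: (@rate_ext 0) (rate_cst 0) => N _; by rewrite big_ord0.
rewrite big_ord_recl; apply: (@rate_ext 0 (fun N => u ord0 N + \sum_i u (lift ord0 i) N)).
  by move=> N _; rewrite big_ord_recl.
by apply: rate_add => //; apply: (IH (fun i => u (lift ord0 i))).
Qed.

Lemma rate_shift s u l : rate u l -> rate (fun N => u (N - s)%N) l.
Proof.
move=> [K [N0 h]]; exists (K * s.+1%:R), (N0 + s)%N => N hN.
have n0 : (N0 <= N - s)%N by lia.
have := h _ n0 => hb; apply: le_trans (hb) _.
have K0 : 0 <= K.
  have := le_trans (normr_ge0 _) hb; by rewrite pmulr_lge0 // invr_gt0 ltr0n.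
rewrite -mulrA; apply: ler_wpM2l => //.
rewrite ler_pdivlMr ?ltr0n // mulrC ler_pdivrMr ?ltr0n // -natrM ler_nat; nia.
Qed.

(** The ratio is (n + 2) / (2 (2n + 1)), at distance 3 / (4 (2n + 1)) from
    1/4. *)
Lemma rate_catalan1 : rate (fun N => (catalan (N - 1))%:R / (catalan N)%:R) (4^-1).
Proof.
exists 3, 1%N => -[//|n] _; rewrite subn1 /=.
have c0 k : 0 < (catalan k)%:R :> R by rewrite ltr0n catalan_gt0.
have := congr1 (fun x => x%:R : R) (catalan_ratio n); rewrite !natrM => e.
have n2 : 0 < n.+2%:R :> R by rewrite ltr0n.
have er : (catalan n)%:R / (catalan n.+1)%:R = n.+2%:R / (n.*2.+1).*2%:R :> R.
  apply: (canLR (mulfK (lt0r_neq0 (c0 _)))).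
  by rewrite mulrAC e [_ * (catalan n)%:R]mulrC mulfK.
have -> : (catalan n)%:R / (catalan n.+1)%:R - 4^-1 = 3 / (4 * n.*2.+1%:R) :> R.
  have eN : n.*2.+1%:R = 2 * n%:R + 1 :> R by rewrite -natr1 -mul2n natrM.
  rewrite er -[(n.*2.+1).*2]mul2n natrM eN -[n.+2]addn2 natrD.
  have : 0 <= n%:R :> R by []. move: (n%:R : R) => x x0.
  by field; lra.
rewrite ger0_norm ?divr_ge0 ?mulr_ge0 // ler_pM2l // lef_pV2 ?posrE ?mulr_gt0 //.
by rewrite -natrM ler_nat; lia.
Qed.

Lemma rate_catalan s : rate (fun N => (catalan (N - s))%:R / (catalan N)%:R) (4^-1 ^+ s).
Proof.
have c0 k : (catalan k)%:R != 0 :> R by rewrite pnatr_eq0 -lt0n catalan_gt0.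
elim: s => [|s IH].
  by apply: (@rate_ext 0) (rate_cst 1) => N _; rewrite subn0 divff.
rewrite exprS; apply: (@rate_ext 0) (rate_mul (rate_shift s rate_catalan1) IH) => N _ /=.
by rewrite -subnDA addn1 mulrA divfK.
Qed.

Definition hit_freq (ds : seq (nat * nat)) (N : nat) : R :=
  (hit_count N ds)%:R / (catalan N)%:R.

(** The general term of the recurrence: normalising a count of size N - s by
    C_N instead of C_(N - s) costs a factor tending to 4^-s. *)
(** Outer induction on the chain, inner induction on the first value b for all
    a at once: both convolutions lower b, and the last term drops the first
    point of the chain.  The factor P of the remaining points is common to all
    three terms, which is why the limit is a product. *)
Lemma rate_hit_freq_shift c s ds l : rate (hit_freq ds) l ->
  rate (fun N => (c * hit_count (N - s) ds)%:R / (catalan N)%:R) (c%:R * 4^-1 ^+ s * l).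
Proof.
have c0 k : (catalan k)%:R != 0 :> R by rewrite pnatr_eq0 -lt0n catalan_gt0.
move=> h; apply: (@rate_ext 0)
  (rate_mul (rate_mul (rate_cst c%:R) (rate_catalan s)) (rate_shift s h)) => N _.
rewrite /hit_freq natrM -!mulrA; congr (_ * _).
by rewrite mulrC -mulrA -mulrA mulVf ?mulr1 // mulrC.
Qed.

(** The recurrence of [hit_count_rec] after division by the Catalan number and
    passage to the limit, for a single point. *)
Lemma rho_ballot_rec a b : (0 < a)%N ->
  rho_ballot R (a, b.+1) =
    \sum_(l < b.+1) (catalan l)%:R * 4^-1 ^+ l.+1 * rho_ballot R (a, b.+1 - l.+1)%N
    + (\sum_(r < a) (catalan r)%:R * 4^-1 ^+ r.+1 * rho_ballot R (a - r.+1, b)%N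
       + ((b == 0) * catalan a.-1)%:R * 4^-1 ^+ a).
Proof.
move=> a0; rewrite {1}/rho_ballot /= rho_num_rec // !natrD !natr_sum !mulrDl !mulr_suml.
have p4 k : 4 ^+ k != 0 :> R by rewrite expf_neq0 // pnatr_eq0.
congr (_ + (_ + _)).
- apply: eq_bigr => l _; rewrite /rho_ballot /= natrM exprVn.
  rewrite (_ : a + b.+1 = l.+1 + (a + (b.+1 - l.+1)))%N; last by have := ltn_ord l; lia.
  by rewrite [in LHS]exprD; field; rewrite !p4.
- apply: eq_bigr => r _; rewrite /rho_ballot /= !natrM exprVn.
  rewrite (_ : a + b.+1 = r.+1 + ((a - r.+1) + b).+1)%N; last by have := ltn_ord r; lia.
  by rewrite [in LHS]exprD [in LHS](exprS _ (_ + _)); field; rewrite !p4.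
- case: b => [|b]; last by rewrite !mul0n !mul0r.
  by rewrite !mul1n natrM exprVn addn1 exprS; field; rewrite p4.
Qed.

Lemma rate_hit_freq ds : all pos_pair ds ->
  rate (hit_freq ds) (\prod_(d <- ds) rho_ballot R d).
Proof.
elim: ds => [_|[a0 b0] ds IH].
  rewrite big_nil; apply: (@rate_ext 0) (rate_cst 1) => N _.
  by rewrite /hit_freq hit_count_nil divff // pnatr_eq0 -lt0n catalan_gt0.
rewrite /= big_cons => /andP[_ dpos]; set P := \prod_(d <- ds) _ in IH *.
elim/ltn_ind: b0 a0 => -[_|b IHb] a.
  rewrite /rho_ballot /= /rho_num big_ord0 !mul0r.
  by apply: (@rate_ext 0) (rate_cst 0) => N _; rewrite /hit_freq hit_count_snd0 mul0r.
have [->|a0] := posnP a.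
  rewrite /rho_ballot /= /rho_num big1 ?mul0r => [|k _]; last first.
    by rewrite (@ballot_eq0 k.+1 0) // muln0.
  by apply: (@rate_ext 0) (rate_cst 0) => N _; rewrite /hit_freq hit_count_fst0 mul0r.
rewrite rho_ballot_rec // !mulrDl !mulr_suml.
(* The recurrence holds once the first point of the chain fits in the word. *)
apply: (@rate_ext (a + b).+1 (fun N =>
  \sum_(l < b.+1) (catalan l * hit_count (N - l.+1) ((a, b.+1 - l.+1) :: ds))%N%:R
     / (catalan N)%:R
  + (\sum_(r < a) (catalan r * hit_count (N - r.+1) ((a - r.+1, b) :: ds))%N%:R
     / (catalan N)%:R
  + (((b == 0) * catalan a.-1) * hit_count (N - a) ds)%N%:R / (catalan N)%:R))).
  move=> [//|n] hn; rewrite /hit_freq hit_count_rec //=; last 3 first.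
  - by rewrite dpos /pos_pair /= a0.
  - by lia.
  - by lia.
  by rewrite !natrD !natr_sum !mulrDl !mulr_suml mulnA.
apply: rate_add; last apply: rate_add.
- apply: rate_sum => l; rewrite -[_ * rho_ballot _ _ * _]mulrA; apply: rate_hit_freq_shift.
  by apply: IHb; lia.
- apply: rate_sum => r; rewrite -[_ * rho_ballot _ _ * _]mulrA; apply: rate_hit_freq_shift.
  exact: IHb.
- exact/rate_hit_freq_shift/IH.
Qed.

Lemma rate_cvg u l : rate u l -> (u @ \oo --> l).
Proof.
move=> [K [N0 h]]; apply/subr_cvg0/cvgr0Pnorm_le => eps e0.
have /cvgr0_norm_le /(_ eps e0) [] : (K * harmonic N @[N --> \oo] --> (0 : R)).
  rewrite -[X in (_ --> X)](mulr0 K).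
  by apply: cvgM; [exact: cvg_cst|exact: cvg_harmonic].
move=> M _ hM; exists (maxn M N0) => // N /=; rewrite geq_max => /andP[/hM + /h].
by move=> hK hu; apply: le_trans hu _; apply: le_trans hK; exact: ler_norm.
Qed.

Lemma rate_bigO u l : rate u l -> (fun N => u N - l) =O_\oo (fun N => N%:R^-1 : R).
Proof.
move=> [K [N0 h]]; apply/eqOP.
exists `|K|; split; first by rewrite num_real.
move=> k Kk; exists (maxn N0 1) => // N /=; rewrite geq_max => /andP[n0 n1].
apply: le_trans (h _ n0) _; rewrite normfV normr_nat.
apply: (@le_trans _ _ (k / N.+1%:R)).
  by rewrite ler_pM2r ?invr_gt0 ?ltr0n // (le_trans (ler_norm K)) // ltW.
apply: ler_wpM2l; first exact: le_trans (ltW Kk).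
by rewrite lef_pV2 ?posrE ?ltr0n // ler_nat.
Qed.

End Rate.

Lemma P312_Sdesc (R : realType) N k (a b : 'I_k -> nat) :
  (forall m, (0 < a m)%N) -> (\sum_l a l <= N)%N ->
  P312 R (Sdesc N (fun j : 'I_k => (N - psum a (rev_ord j) + 1)%N)
                  (fun j : 'I_k => psum b (rev_ord j))) =
  hit_freq R [seq (a l, b l) | l <- enum 'I_k] N.
Proof.
move=> a0 aN; rewrite /P312 /hit_freq card_S312_catalan -card_Sdesc //.
congr (_%:R / _); apply: eq_card => s; by rewrite !inE andbAC andbb.
Qed.

(** The error term is forced to be the relative one, defined by division by
    the positive limit. *)
Lemma P312_Sdesc_asymptotics (R : realType) (k : nat) (a b : 'I_k -> nat) :
  (forall m : 'I_k, (0 < a m)%N) -> (forall m : 'I_k, (0 < b m)%N) ->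
  exists e : nat -> R,
    e =O_\oo (fun N : nat => (N%:R)^-1 : R) /\
    \forall N \near \oo,
      P312 R (Sdesc N (fun j : 'I_k => (N - psum a (rev_ord j) + 1)%N)
                      (fun j : 'I_k => psum b (rev_ord j)))
      = (\prod_(v < k) rho R (a v) (b v)) * (1 + e N).
Proof.
move=> a0 b0; set ds := [seq (a l, b l) | l <- enum 'I_k].
have dpos : all pos_pair ds.
  by apply/allP => _ /mapP[l _ ->]; rewrite /pos_pair a0 b0.
have -> : \prod_(v < k) rho R (a v) (b v) = \prod_(d <- ds) rho_ballot R d.
  rewrite big_map -big_enum /=; apply: eq_bigr => v _; exact: rho_ballotE.
set P := \prod_(d <- ds) _.
have P0 : P != 0.
  rewrite /P prodf_seq_neq0; apply/allP => d /(allP dpos) /= d0.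
  by rewrite gt_eqF // rho_ballot_gt0.
exists (fun N => hit_freq R ds N / P - 1); split.
  by have := rate_bigO (rate_mul (rate_hit_freq R dpos) (rate_cst P^-1)); rewrite divff.
exists (\sum_l a l)%N => // N /= hN.
by rewrite P312_Sdesc // addrC subrK mulrC divfK.
Qed.

Theorem proposition2p15 (R : realType) :
  (forall a b : nat, (0 < a)%N -> (0 < b)%N ->
     P312 R (Spoint N (N - a + 1) b) @[N --> \oo] --> rho R a b)
  /\
  (forall (k : nat) (a b : 'I_k -> nat), (0 < k)%N ->
     (forall m : 'I_k, (0 < a m)%N) -> (forall m : 'I_k, (0 < b m)%N) ->
     exists e : nat -> R,
       e =O_\oo (fun N : nat => (N%:R)^-1 : R) /\
       \forall N \near \oo,
         P312 R (Sdesc N (fun j : 'I_k => (N - psum a (rev_ord j) + 1)%N)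
                         (fun j : 'I_k => psum b (rev_ord j)))
         = (\prod_(v < k) rho R (a v) (b v)) * (1 + e N)).
Proof.
split=> [a b a0 b0|k a b _]; last exact: P312_Sdesc_asymptotics.
apply: rate_cvg.
apply: (@rate_ext R a (hit_freq R [:: (a, b)])).
  move=> N aN; rewrite Spoint_Sdesc P312_Sdesc //; last by rewrite big_ord1.
  by rewrite enum_ordSl enum_ord0.
have -> : rho R a b = \prod_(d <- [:: (a, b)]) rho_ballot R d.
  by rewrite big_seq1 rho_ballotE.
by apply: rate_hit_freq; rewrite /= /pos_pair /= a0 b0.
Qed.
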